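(* Let $p$ be an odd prime. Then $$|\mathcal D_2(p)|=\frac{(p-1)(p-3)}{2}+2=\frac{p^2-4p+7}{2}.$$
   Context: A binary necklace of length $n$ is an orbit $[w]$ of words $w\in\{0,1\}^n$ (indices in $\mathbb Z/n\mathbb Z$) under rotation $(\mathrm{rot}^k w)_i=w_{i-k}$; reversals and complements are not identified. For $n\ge2$ let $d_w(k)=|\{i\in\mathbb Z/n\mathbb Z:w_i\ne w_{i-k}\}|$ and $\delta(w)=\min_{1\le k\le n-1}d_w(k)$, which depends only on the necklace. $\mathcal D_2(n)$ is the set of binary necklaces $[w]$ of length $n$ with $\delta(w)=2$. *)

(* Defs.v *)
From mathcomp Require Import all_boot all_algebra.

Set Implicit Arguments.
Unset Strict Implicit.
Unset Printing Implicit Defensive.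

Import GRing.Theory.
Local Open Scope ring_scope.

(* All the notions below are meant for n >= 2, where 'Z_n is really Z/nZ. *)
Definition word (n : nat) : finType := {ffun 'Z_n -> bool}.

Definition rotw n (k : 'Z_n) (w : word n) : word n := [ffun i => w (i - k)].

Definition necklace n (w : word n) : {set word n} :=
  [set rotw k w | k : 'Z_n].

Definition dw n (w : word n) (k : 'Z_n) : nat :=
  #|[set i : 'Z_n | w i != w (i - k)]|.

(* The initial value dw w 1 is itself one of the terms (1 != 0 in 'Z_n), so
   this is exactly the minimum over the nonzero shifts. *)
Definition delta n (w : word n) : nat :=
  \big[minn/dw w 1]_(k : 'Z_n | k != 0) dw w k.

Lemma delta_rotw n (j : 'Z_n) (w : word n) : delta (rotw j w) = delta w.
Proof.
have dE k : dw (rotw j w) k = dw w k.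
  rewrite /dw -[RHS](card_imset _ (addIr j)); apply: eq_card => i.
  rewrite !inE !ffunE; apply/idP/imsetP => [wi|[i' + ->]].
    exists (i - j); last by rewrite subrK.
    by rewrite inE addrAC.
  by rewrite inE addrK [_ - k - j]addrAC addrK.
by rewrite /delta dE; apply: eq_bigr => k _; rewrite dE.
Qed.

(* A necklace belongs to D2 n as soon as one of its words has delta = 2, all of
   them then do by delta_rotw. *)
Definition D2 (n : nat) : {set {set word n}} :=
  [set necklace w | w : word n & delta w == 2%N].

(* Main.v *)
(* Since p is prime, dilating the indices by 1/k turns d_w(k) = 2 into
   d_u(1) = 2, which says that u is a cyclic run of m ones, 0 < m < p.  So the
   words with delta = 2 are the indicators of arithmetic progressions of
   length m and nonzero difference k.  If 1 < m < p - 1, a run of length m has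
   d(l) = 2 only for l = 1 or -1, so k is determined up to sign, and opposite
   differences do give the same necklace; if m is 1 or p - 1, all differences
   give the same necklace.  This leaves (p - 1) / 2 * (p - 3) + 2 necklaces. *)

Require Import Defs.
From mathcomp Require Import all_boot all_order all_algebra.
From mathcomp Require Import zify ring.

Set Implicit Arguments.
Unset Strict Implicit.
Unset Printing Implicit Defensive.

Import Order.TTheory GRing.Theory.
Local Open Scope ring_scope.

(** * Representatives in Z/nZ *)

Lemma ltn_Zp n (n_gt1 : (1 < n)%N) (i : 'Z_n) : (i < n)%N.
Proof. by rewrite -[X in (_ < X)%N](Zp_cast n_gt1). Qed.

(** Splitting on the wrap-around instead of reducing modulo [n] turns membership in a shifted arc
    into linear arithmetic, within reach of [lia]. *)
Lemma val_subZp n (n_gt1 : (1 < n)%N) (i j : 'Z_n) :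
  nat_of_ord (i - j) = (if (j <= i)%N then i - j else n + i - j)%N.
Proof.
have := ltn_Zp n_gt1 i; have := ltn_Zp n_gt1 j.
have -> : nat_of_ord (i - j) = ((i + (n - j)) %% n)%N.
  rewrite /= modnDmr [X in (_ %% X)%N]Zp_cast //.
  by rewrite [X in (_ + (X - _))%N]Zp_cast.
move=> lt_jn lt_in.
case: leqP => le_ji.
  by rewrite addnBA 1?ltnW // addnC -addnBA // modnDl modn_small //; lia.
by rewrite modn_small; lia.
Qed.

Lemma val_natZp n (n_gt1 : (1 < n)%N) k : (k < n)%N -> nat_of_ord (k%:R : 'Z_n) = k.
Proof. by move=> lt_kn; rewrite val_Zp_nat // modn_small. Qed.

Lemma val_oneZp n (n_gt1 : (1 < n)%N) : nat_of_ord (1 : 'Z_n) = 1%N.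
Proof. by rewrite -[1]/(1%:R) val_natZp. Qed.

(** * Arcs, dilations, and the behaviour of [dw] under symmetries *)

Definition arc n m : word n := [ffun i : 'Z_n => (i < m)%N].

Definition dilw n (k : 'Z_n) (w : word n) : word n := [ffun i => w (k * i)].

Lemma dw_rotw n (a k : 'Z_n) (w : word n) : dw (rotw a w) k = dw w k.
Proof.
rewrite /dw -[LHS](card_imset _ (addIr (- a))); apply: eq_card => i.
rewrite inE; apply/imsetP/idP => [[j + ->]|wi].
  by rewrite inE !ffunE addrAC.
by exists (i + a); rewrite ?addrK // inE !ffunE addrK [_ - k]addrAC addrK.
Qed.

Lemma dw_opp n (k : 'Z_n) (w : word n) : dw w (- k) = dw w k.
Proof.
rewrite /dw -[LHS](card_imset _ (addIr k)); apply: eq_card => i.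
rewrite inE; apply/imsetP/idP => [[j + ->]|wi].
  by rewrite inE opprK addrK eq_sym.
by exists (i - k); rewrite ?subrK // inE opprK subrK eq_sym.
Qed.

Lemma dw_dilw n (k l : 'Z_n) (w : word n) :
  k \is a GRing.unit -> dw (dilw k w) l = dw w (k * l).
Proof.
move=> Uk; rewrite /dw -[LHS](card_imset _ (mulrI Uk)); apply: eq_card => i.
rewrite inE; apply/imsetP/idP => [[j + ->]|wi].
  by rewrite inE !ffunE mulrBr.
by exists (k^-1 * i); rewrite ?mulVKr // inE !ffunE mulrBr mulVKr.
Qed.

Lemma rotwD n (a b : 'Z_n) (w : word n) : rotw a (rotw b w) = rotw (a + b) w.
Proof. by apply/ffunP => i; rewrite !ffunE opprD addrA. Qed.

Lemma rotw0 n (w : word n) : rotw 0 w = w.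
Proof. by apply/ffunP => i; rewrite !ffunE subr0. Qed.

Lemma necklace_rotw n (a : 'Z_n) (w : word n) : necklace (rotw a w) = necklace w.
Proof.
apply/setP => v; apply/imsetP/imsetP => [[b _ ->]|[b _ ->]].
  by exists (b + a); rewrite ?rotwD.
by exists (b - a); rewrite ?rotwD ?subrK.
Qed.

Lemma necklace_eqP n (v w : word n) :
  necklace v = necklace w -> exists a, v = rotw a w.
Proof.
move=> eq_vw; have : v \in necklace v by apply/imsetP; exists 0; rewrite ?rotw0.
by rewrite eq_vw => /imsetP[a _ ->]; exists a.
Qed.

Lemma dw_arc1 n m (n_gt1 : (1 < n)%N) :
  (0 < m < n)%N -> dw (arc n m) 1 = 2.
Proof.
move=> m_bnd; have mE := @val_natZp n n_gt1 m ltac:(lia).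
have ne0m : (0 : 'Z_n) != m%:R.
  by apply/eqP => /(congr1 (@nat_of_ord _)); rewrite mE /=; lia.
(* Shifting the arc by 1 loses its first point 0 and gains the point [m]. *)
rewrite /dw; suff -> : [set i | arc n m i != arc n m (i - 1)] = [set 0; m%:R].
  by rewrite cards2 ne0m.
apply/setP => i; rewrite !inE !ffunE val_subZp // val_oneZp //.
rewrite -!val_eqE /= in ne0m *; rewrite mE; have := ltn_Zp n_gt1 i.
by case: ifP; lia.
Qed.

(** Lower bounds on [dw] are obtained by exhibiting distinct disagreements. *)
Lemma dw_uniq_leq n (s : seq 'Z_n) (w : word n) l :
  uniq s -> all (fun i => w i != w (i - l)) s -> (size s <= dw w l)%N.
Proof.
move=> /card_uniqP <- /allP s_w; apply/subset_leq_card/subsetP => i /s_w.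
by rewrite inE.
Qed.

Lemma val_oppZp n (n_gt1 : (1 < n)%N) (l : 'Z_n) : l != 0 ->
  nat_of_ord (- l) = (n - l)%N.
Proof.
rewrite -val_eqE -sub0r val_subZp //= => l0; case: ifP; lia.
Qed.

(* By symmetry 2 l <= n; according to whether the shifted arc wraps around, the
   points 0, 1, l + m - 1 or m, m + 1, l - 1 witness disagreements. *)
Lemma dw_arc_bounds n m (n_gt1 : (1 < n)%N) (l : 'Z_n) :
  (0 < m < n)%N -> l != 0 ->
  (1 < dw (arc n m) l)%N /\
  ((1 < m < n.-1)%N -> l != 1 -> l != -1 -> (2 < dw (arc n m) l)%N).
Proof.
move=> m_bnd; wlog le_l : l / (2 * l <= n)%N => [Hw|].
  case: (leqP (2 * l) n) => [/Hw //|lt_l] l0.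
  rewrite -dw_opp; have [||? Hgt2] := Hw (- l); rewrite ?oppr_eq0 ?val_oppZp //.
    lia.
  by split=> // ? ? ?; apply: Hgt2; rewrite ?eqr_opp // eqr_oppLR.
move=> l0.
have nE k : (k < n)%N -> nat_of_ord (k%:R : 'Z_n) = k by exact: val_natZp.
have l_gt0 : (0 < l)%N by rewrite lt0n -(val_eqE l 0) in l0 *.
have lt_ln := ltn_Zp n_gt1 l.
have dis k : (k < n)%N ->
  ((k < m) != ((if l <= k then k - l else n + k - l) < m))%N ->
  arc n m k%:R != arc n m (k%:R - l).
  by move=> lt_kn; rewrite !ffunE val_subZp // nE.
have neq i j : (i < n)%N -> (j < n)%N -> (i != j)%N -> (i%:R : 'Z_n) != j%:R.
  by move=> lt_in lt_jn; rewrite -val_eqE /= !nE.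
case: (leqP l (n - m)) => l_m; split => [|m_bnd' l1 _].
- apply: (@dw_uniq_leq _ [:: 0%:R; (l + m - 1)%:R]) => /=.
    by rewrite inE neq //; lia.
  by rewrite !dis //; repeat case: ifP; lia.
- have {}l1 : (nat_of_ord l != 1)%N by rewrite -(val_oneZp n_gt1).
  apply: (@dw_uniq_leq _ [:: 0%:R; 1%:R; (l + m - 1)%:R]) => /=.
    by rewrite !inE negb_or !neq //; lia.
  by rewrite !dis //; repeat case: ifP; lia.
- apply: (@dw_uniq_leq _ [:: m%:R; (l - 1)%:R]) => /=.
    by rewrite inE neq //; lia.
  by rewrite !dis //; repeat case: ifP; lia.
- apply: (@dw_uniq_leq _ [:: m%:R; m.+1%:R; (l - 1)%:R]) => /=.
    by rewrite !inE negb_or !neq //; lia.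
  by rewrite !dis //; repeat case: ifP; lia.
Qed.

(** * Words with two changes at shift 1, and the minimum over shifts *)

(** Walking up from [j] by steps of 1, the first one met is preceded by a zero. *)
Lemma exists_rise n (u : word n) i j : u i -> ~~ u j ->
  exists2 a, u a & ~~ u (a - 1).
Proof.
move=> ui uj; have ex_k : exists k, u (j + k%:R).
  by exists (i - j : 'Z_n); rewrite natr_Zp addrC subrK.
have [[|k] uk min_k] := ex_minnP ex_k; first by rewrite addr0 (negPf uj) in uk.
exists (j + k.+1%:R) => //; rewrite -natr1 addrA addrK.
by apply/negP => /min_k; rewrite ltnn.
Qed.

(* From a rise at [a], the run of ones ends at a first [m]; these are the two
   changes, so that there is no other one. *)
Lemma dw1_eq2 n (n_gt1 : (1 < n)%N) (u : word n) : dw u 1 = 2 ->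
  exists (a : 'Z_n) m, (0 < m < n)%N /\ u = rotw a (arc n m).
Proof.
move=> du.
have [a ua ua1] : exists2 a, u a & ~~ u (a - 1).
  have /card_gt0P[i] : (0 < dw u 1%R)%N by rewrite du.
  rewrite inE; case ui: (u i); case ui1: (u (i - 1)) => // _.
    by exists i; rewrite ?ui1.
  by apply: (@exists_rise _ u (i - 1) i); rewrite ?ui ?ui1.
pose v k := u (a + k%:R).
(* Since [n.-1] is -1 in 'Z_n, this is the zero before the rise; it forces the run from [a] to stop
   before wrapping around. *)
have vn : ~~ v n.-1.
  by rewrite /v -subn1 natrB ?pchar_Zp ?sub0r // ltnW.
have [m vm min_m] := ex_minnP (ex_intro (fun k => ~~ v k) _ vn).
have m_bnd : (0 < m < n)%N.
  have := min_m _ vn; rewrite andbC; case: m vm {min_m} => [|m] vm; last by lia.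
  by rewrite /v addr0 ua in vm.
exists a, m; split => //.
have v_lt k : (k < m)%N -> v k by apply: contraTT => /min_m; rewrite -leqNgt.
have vS k : (m <= k)%N -> (k.+1 < n)%N -> v k.+1 = v k.
  move=> le_mk lt_kn; apply/eqP; apply: contraPT du => neq_v.
  suff : (2 < dw u 1%R)%N by move=> + E; rewrite E.
  apply: (@dw_uniq_leq _ [:: a + 0%:R; a + m%:R; a + k.+1%:R]).
    rewrite /= !inE negb_or !(inj_eq (addrI a)) -!val_eqE /= !val_natZp //; lia.
  have sub1 j : a + j.+1%:R - 1 = a + j%:R by rewrite -natr1 addrA addrK.
  rewrite /= addr0 ua (negPf ua1) /= sub1 neq_v.
  case: m m_bnd vm v_lt {min_m le_mk} => // m _ vm v_lt.
  by rewrite sub1 [u (a + m%:R)]v_lt // -[u _]/(v _) (negPf vm).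
have v_ge k : (m + k < n)%N -> ~~ v (m + k)%N.
  by elim: k => [|k IHk]; rewrite ?addn0 // addnS => ?; rewrite vS ?IHk //; lia.
apply/ffunP => i; rewrite !ffunE.
have -> : u i = v (i - a : 'Z_n) by rewrite /v natr_Zp addrC subrK.
case: ltnP => [/v_lt //|le_m]; apply/negbTE.
by rewrite -(subnKC le_m) v_ge // subnKC // ltn_Zp.
Qed.

Lemma delta_attained n (w : word n) : exists2 k, k != 0 & dw w k = delta w.
Proof.
rewrite /delta; elim/big_ind: _ => [|x y [k k0 <-] [l l0 <-]|k k0].
(* The initial value of the minimum is attained too, at shift 1. *)
- by exists 1; rewrite ?oner_neq0.
- by rewrite /minn; case: ifP => _; [exists k | exists l].
- by exists k.
Qed.

Lemma delta_le n (w : word n) k : k != 0 -> (delta w <= dw w k)%N.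
Proof. by move=> k0; apply: (@bigmin_le_cond _ nat _ _ k _ (dw w) k0). Qed.

(** * Arithmetic progressions modulo a prime *)

Section Progressions.

Variables (p : nat) (p_prime : prime p).
Implicit Types (k l : 'Z_p) (w : word p).

Let p_gt1 := prime_gt1 p_prime.

Lemma unit_Zp_prime k : k != 0 -> k \is a GRing.unit.
Proof.
rewrite -[k in X in _ -> X]natr_Zp unitZpE // prime_coprime // -val_eqE /= => k0.
by rewrite gtnNdvd ?ltn_Zp // lt0n.
Qed.

(** For [k != 0] and [m < p], the ones are at 0, k, ..., (m - 1) k; the inverse appears because
    [dilw] multiplies the index before reading the word. *)
Definition progression k m : word p := dilw k^-1 (arc p m).

Lemma dw_progression a k m l : k != 0 ->
  dw (rotw a (progression k m)) l = dw (arc p m) (k^-1 * l).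
Proof. by move=> k0; rewrite dw_rotw dw_dilw ?unitrV ?unit_Zp_prime. Qed.

(** This recovers [m] from the necklace. *)
Lemma card_progression a k m : k != 0 -> (m < p)%N ->
  #|[set i | rotw a (progression k m) i]| = m.
Proof.
move=> k0 lt_mp; have Uk := unit_Zp_prime k0.
have inj_f : injective (fun j : 'I_m => k * (j : nat)%:R + a).
  move=> i j /addIr/(mulrI Uk)/(congr1 (@nat_of_ord _)).
  by rewrite !val_natZp ?(leq_trans (ltn_ord _) (ltnW lt_mp)) // => /val_inj.
rewrite -[RHS]card_ord -(card_image inj_f); apply: eq_card => i.
rewrite inE !ffunE; apply/idP/imageP => [lt_im|[j _ ->]].
  by exists (Ordinal lt_im); rewrite // (natr_Zp (k^-1 * _)) mulVKr ?subrK.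
by rewrite addrK mulKr // val_natZp // (leq_trans (ltn_ord _) (ltnW lt_mp)).
Qed.

Lemma dw_eq2_progression w k : k != 0 -> dw w k = 2 ->
  exists (a : 'Z_p) m, (0 < m < p)%N /\ w = rotw a (progression k m).
Proof.
move=> k0; have Uk := unit_Zp_prime k0.
rewrite -[k in dw w k]mulr1 -dw_dilw // => /(dw1_eq2 p_gt1)[a [m [m_bnd wE]]].
exists (k * a), m; split=> //; apply/ffunP=> i.
have /ffunP/(_ (k^-1 * i)) := wE.
by rewrite !ffunE mulVKr // mulrBr mulKr.
Qed.

Lemma delta_progression a k m : k != 0 -> (0 < m < p)%N ->
  delta (rotw a (progression k m)) = 2.
Proof.
move=> k0 m_bnd; have Uk := unit_Zp_prime k0.
apply/eqP; rewrite eqn_leq; apply/andP; split.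
  by rewrite -(dw_arc1 p_gt1 m_bnd) -(mulVr Uk) -(dw_progression a) // delta_le.
have [l l0 <-] := delta_attained (rotw a (progression k m)).
rewrite dw_progression //; apply: (dw_arc_bounds p_gt1 m_bnd _).1.
by apply: contraNneq l0 => kl0; rewrite -[l](mulVKr Uk) kl0 mulr0.
Qed.

(** Read backwards, the progression 0, -k, ..., -(m - 1) k starts at -(m - 1) k and has difference
    k. *)
Lemma progression_opp k m : k != 0 -> (0 < m < p)%N ->
  progression (- k) m = rotw (- (k * m.-1%:R)) (progression k m).
Proof.
move=> k0 m_bnd; have Uk := unit_Zp_prime k0.
apply/ffunP=> i; rewrite !ffunE opprK mulrDr mulKr // invrN mulNr.
(* What remains is that the reflection sending j to m - 1 - j preserves the arc. *)
set j := - (_ * i); rewrite -[k^-1 * i]opprK -/j addrC.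
rewrite val_subZp // val_natZp //; last by lia.
have := ltn_Zp p_gt1 j; case: ifP; lia.
Qed.

Lemma progression1 k : k != 0 -> progression k 1 = progression 1 1.
Proof.
move=> k0; have Uk := unit_Zp_prime k0.
apply/ffunP=> i; rewrite !ffunE invr1 mul1r !ltnS !leqn0.
by rewrite !(val_eqE _ (0 : 'Z_p)) mulrI_eq0 //; apply: mulrI; rewrite unitrV.
Qed.

(** The only zero of [progression k p.-1] is at -k, and rotating by 1 - k moves -1 there. *)
Lemma progression_pred k : k != 0 ->
  progression k p.-1 = rotw (1 - k) (progression 1 p.-1).
Proof.
move=> k0; have Uk := unit_Zp_prime k0.
have ltE (i : 'Z_p) : (i < p.-1)%N = (i != -1).
  have m1E : val (-1 : 'Z_p) = p.-1.
    by rewrite [LHS]val_oppZp ?oner_neq0 // val_oneZp // subn1.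
  by rewrite -val_eqE m1E /=; have := ltn_Zp p_gt1 i; lia.
apply/ffunP=> i; rewrite !ffunE invr1 mul1r !ltE; congr (~~ _).
rewrite -(inj_eq (mulrI Uk)) mulVKr // mulrN1.
by rewrite opprB addrA subr_eq addrC addNr [RHS]addr_eq0 eq_sym -eqr_oppLR.
Qed.

End Progressions.

(** * Parametrization of the necklaces and the count *)

(** Pairs (difference, length): [inl] covers differences 1 to (p - 1) / 2, one per sign class, with
    lengths 2 to p - 2; [inr] covers the lengths 1 and p - 1, with difference 1. *)
Definition param p (t : 'I_p./2 * 'I_(p - 3) + bool) : nat * nat :=
  match t with
  | inl (i, j) => (i.+1, j.+2)
  | inr b => (1%N, if b then 1%N else p.-1)
  end.

Lemma param_inj p : odd p -> (2 < p)%N -> injective (@param p).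
Proof.
move=> p_odd p_gt2 [[i j]|b] [[i' j']|b'] //= [].
- by move=> /val_inj-> /val_inj->.
- by move=> _; have := ltn_ord j; case: b'; lia.
- by move=> _; have := ltn_ord j'; case: b; lia.
- by case: b b' => [] [] //; lia.
Qed.

Lemma param_bounds p t : odd p -> (2 < p)%N ->
  [/\ (0 < (@param p t).1)%N, (2 * (@param p t).1 < p)%N,
      (0 < (@param p t).2 < p)%N &
      (1 < (@param p t).2 < p.-1)%N || ((@param p t).1 == 1)%N].
Proof.
move=> p_odd p_gt2; case: t => [[i j]|b] /=; last by case: b; split; lia.
by have := ltn_ord i; have := ltn_ord j; split; lia.
Qed.

Lemma paramP p k m : (0 < k)%N -> (2 * k < p)%N -> (1 < m < p.-1)%N ->
  exists t, @param p t = (k, m).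
Proof.
move=> k_gt0 lt_kp m_bnd.
have lt_i : (k.-1 < p./2)%N by lia.
have lt_j : (m - 2 < p - 3)%N by lia.
exists (inl (Ordinal lt_i, Ordinal lt_j)) => /=.
by congr (_, _); lia.
Qed.

Section Count.

Variables (p : nat) (p_prime : prime p) (p_odd : odd p).

Let p_gt1 := prime_gt1 p_prime.
Let p_gt2 := odd_prime_gt2 p_odd p_prime.

Definition param_necklace t : {set word p} :=
  necklace (progression (@param p t).1%:R (@param p t).2).

Lemma natr_Zp_neq0 k : (0 < k < p)%N -> (k%:R : 'Z_p) != 0.
Proof. by move=> k_bnd; rewrite -val_eqE /= val_natZp //; lia. Qed.

Lemma param_necklace_inj : injective param_necklace.
Proof.
move=> t t' /necklace_eqP[a]; rewrite -[progression (param t).1%:R _]rotw0.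
have [k_gt0 lt_k m_bnd km] := @param_bounds p t p_odd p_gt2.
have [k'_gt0 lt_k' m'_bnd km'] := @param_bounds p t' p_odd p_gt2.
move: (@param_inj p p_odd p_gt2 t t') km km' k_gt0 lt_k m_bnd k'_gt0 lt_k' m'_bnd.
case: (param t) (param t') => [k m] [k' m'] /= kmE km km' k_gt0 lt_k m_bnd.
move=> k'_gt0 lt_k' m'_bnd eq_w; apply: kmE.
have k0 : (k%:R : 'Z_p) != 0 by apply: natr_Zp_neq0; lia.
have k'0 : (k'%:R : 'Z_p) != 0 by apply: natr_Zp_neq0; lia.
have Uk' := unit_Zp_prime p_prime k'0.
have eq_m : m = m'.
  rewrite -(@card_progression p p_prime 0 k%:R m k0) ?eq_w; last by lia.
  by rewrite card_progression //; lia.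
rewrite -{}eq_m in km' m'_bnd eq_w *; congr (_, m).
(* For the extreme lengths both differences are 1 by construction. *)
have [m1|m1] := boolP (1 < m < p.-1)%N; last first.
  by move: km km'; rewrite (negPf m1) => /= /eqP-> /eqP->.
(* The shift k gives 2 for the first progression, hence for the second, where it is the shift k / k'
   of the arc; so k / k' is 1 or -1. *)
have := @dw_progression p p_prime 0 k%:R m k%:R k0.
rewrite eq_w dw_progression // mulVr ?unit_Zp_prime // dw_arc1 // => d2.
have l0 : (k'%:R : 'Z_p)^-1 * k%:R != 0.
  by apply: contraNneq k0 => l0; rewrite -[k%:R](mulVKr Uk') l0 mulr0.
have divE (x : 'Z_p) : (k'%:R^-1 * k%:R == x) = (k%:R == k'%:R * x).
  by rewrite -(inj_eq (mulrI Uk')) mulVKr.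
have [_ /(_ m1)] := dw_arc_bounds p_gt1 m_bnd l0.
rewrite d2 !divE mulr1 mulrN1 => d_gt2.
have [eq_k|neq_k] := eqVneq (k%:R : 'Z_p) k'%:R.
  have := congr1 (@nat_of_ord _) eq_k; rewrite !val_natZp //; lia.
(* k = -k' would give k + k' = p, but both are below p / 2. *)
have [eq_k|neq_kN] := eqVneq (k%:R : 'Z_p) (- k'%:R).
  have := congr1 (@nat_of_ord _) eq_k.
  by rewrite val_oppZp // !val_natZp //; lia.
by have := d_gt2 neq_k neq_kN.
Qed.

Lemma param_necklace_onto k m : k != 0 -> (0 < m < p)%N ->
  exists t, necklace (@progression p k m) = param_necklace t.
Proof.
move=> k0 m_bnd.
have [m1|m1] := boolP (1 < m < p.-1)%N; last first.
  have [->|m_neq1] := eqVneq m 1%N.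
    by exists (inr true); rewrite progression1.
  exists (inr false); have -> : m = p.-1 by lia.
  by rewrite progression_pred // necklace_rotw.
(* As [p] is odd, either [k] or [-k] has its representative below p / 2. *)
wlog le_k : k k0 / (2 * k < p)%N => [Hw|].
  case: (ltnP (2 * k) p) => [|ge_k]; first exact: Hw.
  have [||t tE] := Hw (- k); rewrite ?oppr_eq0 ?val_oppZp //; first by lia.
  by exists t; rewrite -tE progression_opp // necklace_rotw.
have [|t tE] := @paramP p k m _ le_k m1.
  by rewrite lt0n -(val_eqE k 0) in k0 *.
by exists t; rewrite /param_necklace tE /= natr_Zp.
Qed.

Lemma D2_param : D2 p = [set param_necklace t | t in setT].
Proof.
apply/setP=> N; apply/imsetP/imsetP => [[w]|[t _ ->]].
  rewrite inE => /eqP dw2 ->; have [k k0] := delta_attained w.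
  rewrite dw2 => /(dw_eq2_progression p_prime k0)[a [m [m_bnd ->]]].
  have [t tE] := param_necklace_onto k0 m_bnd.
  by exists t; rewrite ?necklace_rotw.
have [k_gt0 lt_k m_bnd _] := @param_bounds p t p_odd p_gt2.
exists (progression (param t).1%:R (param t).2) => //.
by rewrite inE -[progression _ _]rotw0 delta_progression // natr_Zp_neq0 //; lia.
Qed.

Lemma card_D2 : #|D2 p| = (p./2 * (p - 3) + 2)%N.
Proof.
rewrite D2_param card_imset; last exact: param_necklace_inj.
by rewrite cardsT card_sum card_prod !card_ord card_bool.
Qed.

End Count.

Theorem corollary6p12 (p : nat) (p_prime : prime p) (p_odd : odd p) :
  (#|D2 p|%:R : rat) = (p%:R - 1) * (p%:R - 3) / 2 + 2 /\
  (p%:R - 1) * (p%:R - 3) / 2 + 2 = (p%:R ^+ 2 - 4 * p%:R + 7) / 2 :> rat.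
Proof.
split; last by field.
have p_gt2 := odd_prime_gt2 p_odd p_prime.
have pE : p%:R = 2 * (p./2)%:R + 1 :> rat.
  by rewrite -[in LHS](odd_double_half p) p_odd natrD -mul2n natrM addrC.
(* The subtraction [p - 3] in [nat] is not truncated, by [p_gt2]. *)
by rewrite card_D2 // natrD natrM natrB // pE; field.
Qed.
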